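(* Let $(\alpha,\omega)$ be a combined voltage assignment on a graph $\Gamma=(V,A)$ with $k$ vertices in a finite group $G$, with $\omega(u)=G_u<G$, and let $n_u=[G:G_u]$ for every $u\in V$, so that the order of the factored lift $\Gamma^{(\alpha,\omega)}$ is $k^{\omega}=\sum_{u\in V}n_u$. Let $G$ have order $n$, with $\nu$ conjugacy classes, and let $\{\rho_r : r=0,1,\ldots,\nu-1\}$ be a complete set of complex irreducible representations of $G$, of dimensions $d(\rho_r)=d_r$, so that $\sum_{r=0}^{\nu-1}d_r^2=n$. For each $r$, let $\mathbf{B}(\rho_r)$ be the complex $d_rk\times d_rk$ block matrix with $d_r\times d_r$ blocks $$\mathbf{B}_{u,v}(\rho_r)=\sum_{a\in\overrightarrow{uv}}\ \sum_{h\in G_u}\rho_r(h\alpha(a)),\qquad u,v\in V.$$ Let $\mathcal{B}$ be the multiset of eigenvalues $$\mathcal{B}=\bigcup_{r=0}^{\nu-1}d_r\,\mathrm{sp}(\mathbf{B}(\rho_r))$$ of cardinality $\sum_{r=0}^{\nu-1}kd_r^2=kn$. Then the following statements hold: (i) The multiset $\mathcal{B}$ contains at most $k^{\omega}=\sum_{u\in V}n_u$ non-zero eigenvalues. (ii) The spectrum of the factored lift $\Gamma^{(\alpha,\omega)}$ is the multiset $\mathcal{B}\setminus\mathcal{Z}$, where $\mathcal{Z}$ is a multiset containing $kn-k^{\omega}$ zeros.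
   Context: Graphs are finite, undirected, and may have loops, semi-edges and parallel edges. They are described by a vertex set $V$ and an arc set $A$, where each arc $a$ has an initial and a terminal vertex and a reverse arc $a^-$ (with $(a^-)^-=a$; $a^-=a$ is allowed for a semi-edge), and $a^-$ goes from the terminal to the initial vertex of $a$. For $u,v\in V$ (not necessarily distinct), $\overrightarrow{uv}$ denotes the set of arcs from $u$ to $v$. A combined voltage assignment on $\Gamma$ in a finite group $G$ is a pair $(\alpha,\omega)$, where $\alpha:A\to G$ satisfies $\alpha(a^-)=\alpha(a)^{-1}$ for every arc $a$, and $\omega$ assigns to every vertex $u\in V$ a subgroup $\omega(u)=G_u$ of $G$. The factored lift $\Gamma^{(\alpha,\omega)}$ is the graph whose vertices are all pairs $(u,H)$ with $u\in V$ and $H\in G/G_u=\{hG_u : h\in G\}$ (left cosets), and whose arcs are all pairs $(a,h)$ with $a\in A$ and $h\in G$; if $a\in\overrightarrow{uv}$, the arc $(a,h)$ goes from $(u,hG_u)$ to $(v,h\alpha(a)G_v)$. Distinct pairs $(a,h)$ are distinct arcs (so parallel arcs may occur). The reverse of the arc $(a,h)$ is $(a^-,h\alpha(a))$. The spectrum of a graph is the multiset of eigenvalues of its adjacency matrix, whose $(x,y)$-entry is the number of arcs from $x$ to $y$. Each representation $\rho_r$ is regarded as a homomorphism from $G$ to the group of invertible complex $d_r\times d_r$ matrices; a complete set of irreducible representations contains exactly one from each equivalence class. The block $\mathbf{B}_{u,v}(\rho_r)$ is the zero matrix if $\overrightarrow{uv}=\emptyset$. For a square complex matrix $M$, $\mathrm{sp}(M)$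 denotes the multiset of its eigenvalues counted with algebraic multiplicity, and $d_r\,\mathrm{sp}(M)$ is the multiset in which every multiplicity of $\mathrm{sp}(M)$ is multiplied by $d_r$. The union in the definition of $\mathcal{B}$ is the multiset union in which multiplicities are added, and $\mathcal{B}\setminus\mathcal{Z}$ is the multiset difference (the multiplicity of $0$ is reduced by $kn-k^\omega$). *)

(* Defs.v *)
From mathcomp Require Export all_boot all_order all_fingroup all_algebra.
From mathcomp Require Export all_character.
From mathcomp Require Export finmap multiset reals complex.

Set Implicit Arguments.
Unset Strict Implicit.
Unset Printing Implicit Defensive.

Import GRing.Theory.

(* A semi-edge is an arc with [grev a = a]; any other edge, loops included,
   consists of two arcs. That [grev a] ends where [a] starts follows from the
   two axioms. *)
Record graph := Graph {
  gvertex : finType;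
  garc : finType;
  gsource : garc -> gvertex;
  gtarget : garc -> gvertex;
  grev : garc -> garc;
  grevK : involutive grev;
  gsource_rev : forall a, gsource (grev a) = gtarget a
}.

Definition arcs_between (Gamma : graph) (u v : gvertex Gamma) :
    {set garc Gamma} :=
  [set a | (gsource a == u) && (gtarget a == v)].

(* The finite group G is the whole of [gT]. *)
Record voltage_assignment (Gamma : graph) (gT : finGroupType) :=
  VoltageAssignment {
    voltage : garc Gamma -> gT;
    vgroup : gvertex Gamma -> {group gT};
    voltage_rev : forall a, voltage (grev a) = ((voltage a)^-1)%g
  }.

Section FactoredLift.

Context (Gamma : graph) (gT : finGroupType).
Context (aw : voltage_assignment Gamma gT).

Local Open Scope group_scope.

(* Pairs (u, H) with H a left coset of [vgroup aw u]. *)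
Definition lift_vertex : finType :=
  {x : gvertex Gamma * {set gT} | x.2 \in lcosets (vgroup aw x.1) [set: gT]}.

Definition lift_arc : finType := (garc Gamma * gT)%type.

Fact mem_lift_vertex (u : gvertex Gamma) (h : gT) :
  (u, h *: vgroup aw u).2 \in
    lcosets (vgroup aw (u, h *: vgroup aw u).1) [set: gT].
Proof. by apply/lcosetsP; exists h; rewrite ?inE. Qed.

Definition coset_vertex (u : gvertex Gamma) (h : gT) : lift_vertex :=
  exist _ (u, h *: vgroup aw u) (mem_lift_vertex u h).

Definition lift_source (b : lift_arc) : lift_vertex :=
  coset_vertex (gsource b.1) b.2.

Definition lift_target (b : lift_arc) : lift_vertex :=
  coset_vertex (gtarget b.1) (b.2 * voltage aw b.1).

Definition lift_rev (b : lift_arc) : lift_arc :=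
  (grev b.1, b.2 * voltage aw b.1).

Fact lift_revK : involutive lift_rev.
Proof. by case=> a h; rewrite /lift_rev /= grevK voltage_rev mulgK. Qed.

Fact lift_source_rev b : lift_source (lift_rev b) = lift_target b.
Proof. by rewrite /lift_source /lift_target /= gsource_rev. Qed.

Definition factored_lift : graph := Graph lift_revK lift_source_rev.

(* MathComp's index counts right cosets; there are as many left cosets. *)
Definition komega : nat :=
  (\sum_(u : gvertex Gamma) #|[set: gT] : vgroup aw u|)%N.

End FactoredLift.

Local Open Scope ring_scope.

Definition adjacency (F : nzRingType) (Gamma : graph) :
    'M[F]_#|gvertex Gamma| :=
  \matrix_(i, j) #|arcs_between (enum_val i) (enum_val j)|%:R.

Local Open Scope mset_scope.

Definition mset_scale (K : choiceType) (d : nat) (A : {mset K}) : {mset K} :=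
  [fsfun x in finsupp A => (d * A x)%N].

Lemma mset_scaleE (K : choiceType) d (A : {mset K}) x :
  mset_scale d A x = (d * A x)%N.
Proof.
by rewrite fsfun_fun; case: finsuppP => // _; rewrite muln0.
Qed.

(* Eigenvalues with algebraic multiplicity: the roots of the characteristic
   polynomial. *)
Definition sp (F : closedFieldType) (n : nat) (M : 'M[F]_n) : {mset F} :=
  seq_mset (sval (closed_field_poly_normal (char_poly M))).

Lemma spE (F : closedFieldType) n (M : 'M[F]_n) x :
  sp M x = mup x (char_poly M).
Proof.
rewrite /sp mset_seqE; case: closed_field_poly_normal => s /= ->.
have /eqP -> : lead_coef (char_poly M) == 1 by exact: char_poly_monic.
by rewrite scale1r mu_prod_XsubC.
Qed.

Definition graph_spectrum (F : closedFieldType) (Gamma : graph) : {mset F} :=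
  sp (adjacency F Gamma).

Section Blocks.

Context (F : closedFieldType) (Gamma : graph) (gT : finGroupType).
Context (aw : voltage_assignment Gamma gT).

Definition voltage_block (d : nat) (rho : mx_representation F [set: gT] d)
    (u v : gvertex Gamma) : 'M[F]_d :=
  \sum_(a in arcs_between u v) \sum_(h in vgroup aw u)
    rho (h * voltage aw a)%g.

(* The size [\sum_(i < k) d], with k the number of vertices, is k * d. *)
Definition voltage_matrix (d : nat) (rho : mx_representation F [set: gT] d) :
    'M[F]_(\sum_(i < #|gvertex Gamma|) d) :=
  \mxblock_(i < #|gvertex Gamma|, j < #|gvertex Gamma|)
    voltage_block rho (enum_val i) (enum_val j).

Definition voltage_spectrum (nu : nat) (d : 'I_nu -> nat)
    (rho : forall r, mx_representation F [set: gT] (d r)) : {mset F} :=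
  \big[msetD/mset0]_(r < nu) mset_scale (d r) (sp (voltage_matrix (rho r))).

End Blocks.

(* Exactly one representative of each equivalence class of irreducible
   representations of [gT]. *)
Definition complete_irr_set (F : fieldType) (gT : finGroupType) (nu : nat)
    (d : 'I_nu -> nat)
    (rho : forall r, mx_representation F [set: gT] (d r)) : Prop :=
  (forall r, mx_irreducible (rho r)) /\
  (forall m (sigma : mx_representation F [set: gT] m),
     mx_irreducible sigma -> exists! r, mx_rsim sigma (rho r)).

(* Main.v *)
From mathcomp Require Import all_solvable.
Require Import Defs.

Set Implicit Arguments.
Unset Strict Implicit.
Unset Printing Implicit Defensive.

Import GRing.Theory Num.Theory.

Local Open Scope ring_scope.
Local Open Scope mset_scope.

(* Let M be the matrix indexed by V x G whose ((u, g), (v, h)) entry counts the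
   arcs a from u to v such that h * alpha(a)^-1 lies in the coset g G_u.
   Its ((u, g), _) row depends only on that coset, and M = P Q where Q P is the
   adjacency matrix of the factored lift; hence the two characteristic
   polynomials agree up to a power of X.
   On the other hand, the matrix coefficients of the irreducible
   representations are the entries of an invertible matrix T with M T = T D,
   where D is block diagonal with d_r copies of B(rho_r) for each r. *)

(** * Characteristic polynomials and multisets of eigenvalues *)

(** Two block eliminations of the same [M]: a unitriangular factor on the right clears its lower
    left block and leaves ['X%:M - P' *m Q'], while a factor of determinant ['X^n] on the left
    clears that block and leaves ['X%:M - Q' *m P']. *)
Lemma char_poly_mulmxC (R : comNzRingType) (m n : nat)
    (P : 'M[R]_(m, n)) (Q : 'M[R]_(n, m)) :
  'X^n * char_poly (P *m Q) = 'X^m * char_poly (Q *m P).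
Proof.
pose P' := map_mx polyC P; pose Q' := map_mx polyC Q.
pose M := block_mx 'X%:M P' Q' 1%:M.
have detM : \det M = char_poly (P *m Q).
  have <- : \det (M *m block_mx 1%:M 0 (- Q') 1%:M) = \det M.
    by rewrite det_mulmx det_lblock !det1 !mulr1.
  rewrite mulmx_block !mulmx0 !mulmx1 !mul1mx !add0r subrr mulmxN.
  by rewrite det_ublock det1 mulr1 /char_poly /char_poly_mx map_mxM.
have detN : \det (block_mx 1%:M 0 (- Q') 'X%:M) = 'X^n.
  by rewrite det_lblock det1 mul1r det_scalar.
rewrite -detM -detN -det_mulmx mulmx_block !mul1mx !mul0mx !addr0 mulmx1.
rewrite mulNmx scalar_mxC addNr det_ublock det_scalar mulNmx addrC.
by rewrite /char_poly /char_poly_mx map_mxM.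
Qed.

Lemma char_poly_castmx (R : comNzRingType) (m n : nat) (e : m = n)
    (A : 'M[R]_m) :
  char_poly (castmx (e, e) A) = char_poly A.
Proof. by case: _ / e; rewrite castmx_id. Qed.

Lemma char_poly_mxdiag (R : comNzRingType) (p : nat) (p_ : 'I_p -> nat)
    (B : forall i, 'M[R]_(p_ i)) :
  char_poly (\mxdiag_i B i) = \prod_i char_poly (B i).
Proof.
elim: p => [|p IHp] in p_ B *.
  (* With no blocks the size is an empty sum, equal to 0 only by rewriting; hence the detour through
     an arbitrary [n]. *)
  have char0 n (A : 'M[R]_n) : n = 0%N -> char_poly A = 1.
    by move=> n0; rewrite n0 in A *; rewrite /char_poly det_mx00.
  by rewrite char0 !big_ord0.
rewrite mxdiag_recl char_poly_castmx big_ord_recl /char_poly char_block_diag_mx.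
by rewrite det_ublock; congr (_ * _); apply: IHp.
Qed.

(** A square row-free [T] is invertible, so [A] and [D] are similar. Cancelling [\det T] avoids the
    inverse, and the equation [m = n] admits sizes that are not convertible. *)
Lemma char_poly_intertwine (F : fieldType) (m n : nat)
    (A : 'M[F]_m) (T : 'M[F]_(m, n)) (D : 'M[F]_n) :
  m = n -> row_free T -> A *m T = T *m D -> char_poly A = char_poly D.
Proof.
move=> e; case: _ / e in T D * => /[!row_free_unit] Tu AT.
have detT : \det (map_mx polyC T) != 0.
  by rewrite det_map_mx polyC_eq0 -unitfE -unitmxE.
apply/(mulIf detT); rewrite /char_poly [RHS]mulrC -!det_mulmx /char_poly_mx.
by rewrite mulmxBl mulmxBr -!map_mxM AT scalar_mxC.
Qed.

Lemma size_sp (F : closedFieldType) (n : nat) (M : 'M[F]_n) : size (sp M) = n.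
Proof.
rewrite /sp (perm_size (perm_eq_seq_mset _)).
case: closed_field_poly_normal => s /= Ms; have := size_char_poly M.
by rewrite Ms (monicP (char_poly_monic M)) scale1r size_prod_XsubC => -[].
Qed.

Lemma mup_Xn (F : fieldType) (n : nat) (x : F) :
  mup x ('X^n) = if x == 0 then n else 0%N.
Proof. by rewrite -(subr0 'X) -polyC0 mup_XsubCX eq_sym. Qed.

Lemma char_poly_neq0 (R : nzRingType) (n : nat) (M : 'M[R]_n) :
  char_poly M != 0.
Proof. exact/monic_neq0/char_poly_monic. Qed.

Lemma mup_prod (F : fieldType) (I : Type) (s : seq I) (f : I -> {poly F}) x :
  (forall i, f i != 0) ->
  mup x (\prod_(i <- s) f i) = (\sum_(i <- s) mup x (f i))%N.
Proof.
move=> f0; elim: s => [|i s IHs]; first by rewrite !big_nil mupNroot ?root1.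
rewrite !big_cons mupM ?IHs //.
by elim/big_ind: _ => //; [exact: oner_neq0 | exact: mulf_neq0].
Qed.

(** The powers of X in [char_poly_mulmxC] affect only the root 0, whose multiplicities then differ
    by [m - n]. *)
Lemma sp_mulmxC (F : closedFieldType) (m n : nat)
    (P : 'M[F]_(m, n)) (Q : 'M[F]_(n, m)) : (n <= m)%N ->
  sp (P *m Q) = msetn (m - n)%N 0 `+` sp (Q *m P).
Proof.
move=> le_nm; apply/msetP => x; rewrite msetE2 msetnE !spE.
have := congr1 (mup x) (char_poly_mulmxC P Q).
rewrite !mupM ?monic_neq0 ?monicXn ?char_poly_monic // !mup_Xn.
case: eqP => _ // /(canRL (addKn _)) ->.
by rewrite addnC -addnBA // addnC.
Qed.

(** * Complete sets of irreducible representations *)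

Section CompleteIrr.

Context (F : closedFieldType) (gT : finGroupType).
Hypothesis F'G : ([pchar F]^'.-group [set: gT])%g.
Context (nu : nat) (d : 'I_nu -> nat).
Context (rho : forall r, mx_representation F [set: gT] (d r)).
Hypothesis rhoP : complete_irr_set rho.

Local Notation G := [set: gT]%G.

(** The group algebra is semisimple, so an element acting as 0 in every irreducible representation
    is 0. This gives the invertibility of the matrix of coefficients. *)
Lemma complete_irr_faithful (c : gT -> F) :
  (forall r, \sum_g c g *: rho r g = 0) -> forall g, c g = 0.
Proof.
move=> c0; have [irr_rho rho_all] := rhoP.
pose sG : irrType F G := DecSocleType (regular_repr F G).
pose aG := regular_repr F G; pose A := \sum_g c g *: aG g.
have opA n (rG : mx_representation F G n) :
    gring_op rG A = \sum_g c g *: rG g.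
  rewrite linear_sum; apply: eq_bigr => g _.
  by rewrite linearZ /= gring_opG ?inE.
have opA0 (i : sG) : gring_op (irr_repr i) A = 0.
  have [r [sim_r _]] := rho_all _ _ (socle_irr i).
  have [f [f' _ hom_f]] := mx_rsim_def sim_r.
  have -> : gring_op (irr_repr i) A = f *m (\sum_g c g *: rho r g) *m f'.
    rewrite opA mulmx_sumr mulmx_suml; apply: eq_bigr => g _.
    rewrite -scalemxAr -scalemxAl; congr (_ *: _).
    by rewrite hom_f ?inE.
  by rewrite c0 mulmx0 mul0mx.
have envA : (A \in group_ring F G)%MS.
  by apply/envelop_mxP; exists c; apply: eq_bigl => g; rewrite inE.
have A0 : A = 0.
  (* The identity is the sum of the Wedderburn idempotents; each product of [A] with one of them
     lies in a simple component, on which the corresponding representation is injective. *)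
  rewrite -[A]mulmx1 -(Wedderburn_sum_id_pchar sG F'G) mulmx_sumr.
  rewrite big1 // => i _.
  have [idl _] := andP (Wedderburn_ideal i).
  apply: (regular_op_inj_pchar (sG := sG) F'G (socle_irr i)).
  - rewrite inE (irr_reprK_pchar F'G); apply: submx_trans idl.
    by rewrite mem_mulsmx ?Wedderburn_id_mem.
  - by rewrite inE linear0 sub0mx.
  rewrite [LHS]gring_opM ?opA0 ?mul0mx ?linear0 //.
  by rewrite -(Wedderburn_sum_pchar sG F'G) (sumsmx_sup i) ?Wedderburn_id_mem.
(* Projecting the regular representation onto [g] recovers the coefficient [c g]. *)
move=> g; have := congr1 (@gring_proj F gT G g) A0.
rewrite linear0 linear_sum (bigD1 g) //= linearZ /= gring_projE ?inE //.
rewrite eqxx big1 ?addr0 => [/matrixP/(_ 0 0)|h /negPf neq_hg].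
  by rewrite !mxE mulr1.
by rewrite linearZ /= gring_projE ?inE // eq_sym neq_hg scaler0.
Qed.

(** Uniqueness of representatives makes [f] injective into the library's irreducible components;
    both sides have as many elements as there are classes, so [f] is a bijection that preserves
    degrees. *)
Lemma sum_complete_irr_degree : nu = #|classes G| ->
  (\sum_r d r ^ 2)%N = #|[set: gT]|.
Proof.
move=> nuE; have [irr_rho rho_all] := rhoP.
pose sG : irrType F G := DecSocleType (regular_repr F G).
have splitG : group_splitting_field F G by exact: group_closure_closed_field.
pose f r := irr_comp sG (rho r).
have sim_f r : mx_rsim (rho r) (irr_repr (f r)) by exact: rsim_irr_comp_pchar.
have f_inj : injective f.
  move=> r s frs; have [t [_ t_uniq]] := rho_all _ _ (irr_rho r).
  rewrite -(t_uniq r) ?(t_uniq s) //; last exact: mx_rsim_refl.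
  by apply: mx_rsim_trans (sim_f r) _; rewrite frs; apply/mx_rsim_sym/sim_f.
have f_bij : bijective f.
  by apply: inj_card_bij; rewrite // card_irr_pchar // card_ord -nuE.
rewrite -(sum_irr_degree_pchar sG F'G splitG).
rewrite (reindex f) /=; last exact: onW_bij.
by apply: eq_bigr => r _; rewrite (mxrank_rsim (sim_f r)).
Qed.

End CompleteIrr.

Lemma sum_enum_val (V : nmodType) (T : finType) (f : T -> V) :
  \sum_(i < #|T|) f (enum_val i) = \sum_x f x.
Proof. by rewrite -big_enum_val; apply: eq_bigl. Qed.

Lemma sum_fiber (M : nmodType) (S T : finType) (v : S) (f : S * T -> M) :
  \sum_(x | x.1 == v) f x = \sum_t f (v, t).
Proof.
rewrite (reindex (pair v)) /=; first by apply: eq_bigl => t; rewrite eqxx.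
by exists snd => [t _|[u t]] //=; rewrite inE /= => /eqP ->.
Qed.

(** * Factorization through the vertices of the lift *)

Section LiftFactorization.

Context (F : closedFieldType) (Gamma : graph) (gT : finGroupType).
Context (aw : voltage_assignment Gamma gT).

Local Notation V := (gvertex Gamma).
Local Notation W := (lift_vertex aw).
Local Notation k := #|V|.
Local Notation VG := (V * gT)%type.

Lemma coset_vertex_eq u v g h :
  (coset_vertex aw u g == coset_vertex aw v h) =
    (u == v) && (h^-1 * g \in vgroup aw v)%g.
Proof.
rewrite -val_eqE /= xpair_eqE; case: eqVneq => //= ->.
by rewrite -mem_lcoset; apply/eqP/lcoset_eqP.
Qed.

Lemma card_lift_vertex : #|W| = komega aw.
Proof.
rewrite card_sig -sum1_card.
rewrite -(pair_big_dep xpredT (fun u H => H \in lcosets (vgroup aw u) [set: gT])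
           (fun _ _ => 1%N)) /=.
by apply: eq_bigr => u _; rewrite sum1_card card_lcosets.
Qed.

Lemma leq_komega : (komega aw <= k * #|[set: gT]|)%N.
Proof.
rewrite -sum_nat_const; apply: leq_sum => u _.
by rewrite dvdn_leq ?cardG_gt0 ?dvdn_indexg.
Qed.

Definition coset_incidence : 'M[F]_(#|{: VG}|, #|W|) :=
  \matrix_(i, j)
    (coset_vertex aw (enum_val i).1 (enum_val i).2 == enum_val j)%:R.

(** The factor Q, with [coset_incidence] as P. A lift arc [(a, g)] is recorded in the column
    [(gtarget a, g * voltage aw a)], before its endpoint is reduced to a coset, so it is counted in
    exactly one column. *)
Definition arc_incidence : 'M[F]_(#|W|, #|{: VG}|) :=
  \matrix_(j, i) \sum_(a | gtarget a == (enum_val i).1)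
    (coset_vertex aw (gsource a) ((enum_val i).2 * (voltage aw a)^-1)%g
       == enum_val j)%:R.

Lemma adjacency_factored_lift :
  adjacency F (factored_lift aw) = arc_incidence *m coset_incidence.
Proof.
apply/matrixP => y z; rewrite !mxE.
under eq_bigr => i _ do rewrite !mxE.
rewrite (sum_enum_val (fun x : VG => (\sum_(a | gtarget a == x.1)
  (coset_vertex aw (gsource a) (x.2 * (voltage aw a)^-1)%g == enum_val y)%:R) *
  (coset_vertex aw x.1 x.2 == enum_val z)%:R)).
under eq_bigr => x _ do rewrite mulr_suml.
rewrite (exchange_big_dep xpredT) //=.
transitivity (\sum_a \sum_h ((coset_vertex aw (gsource a) h == enum_val y) &&
   (coset_vertex aw (gtarget a) (h * voltage aw a)%g == enum_val z))%:R : F).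
  rewrite pair_bigA -sum1_card natr_sum big_mkcond /=.
  by apply: eq_bigr => b _; rewrite -mulrb inE.
apply: eq_bigr => a _; under [RHS]eq_bigl => x do rewrite eq_sym.
(* The substitution trades the group element at the end of a lift arc for the one at its start. *)
rewrite sum_fiber /= [RHS](reindex_inj (mulIg (voltage aw a))) /=.
by apply: eq_bigr => h _; rewrite mulgK -natrM mulnb.
Qed.

Lemma coset_arc_incidenceE x y :
  (coset_incidence *m arc_incidence) x y =
    \sum_(a | gtarget a == (enum_val y).1)
    (coset_vertex aw (gsource a) ((enum_val y).2 * (voltage aw a)^-1)%g
       == coset_vertex aw (enum_val x).1 (enum_val x).2)%:R.
Proof.
set v := coset_vertex aw _ _.
rewrite mxE (bigD1 (enum_rank v)) //= !mxE enum_rankK eqxx mul1r.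
rewrite [X in _ + X]big1 ?addr0 // => j.
rewrite -(can_eq enum_valK) !mxE enum_rankK -/v.
by rewrite eq_sym => /negPf ->; rewrite mul0r.
Qed.

(** * Coefficients of a single representation *)

Section Block.

Context (d : nat) (rho : mx_representation F [set: gT] d).

Definition coefficient_block (i : 'I_d) (v : 'I_k) : 'M[F]_(#|{: VG}|, d) :=
  \matrix_(x, l) (((enum_val x).1 == enum_val v)%:R * rho (enum_val x).2 i l).

Lemma coefficient_blockM i v m (B : 'M[F]_(d, m)) x l :
  (coefficient_block i v *m B) x l =
    ((enum_val x).1 == enum_val v)%:R * (rho (enum_val x).2 *m B) i l.
Proof.
by rewrite !mxE mulr_sumr; apply: eq_bigr => j _; rewrite mxE mulrA.
Qed.

Definition coefficient_mx (i : 'I_d) : 'M[F]_(#|{: VG}|, \sum_(v < k) d) :=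
  \mxrow_v coefficient_block i v.

(** Multiplicativity of [rho] moves the sum over arcs to the right of [rho g], where it is a voltage
    block. The row index [i] is untouched, so each of the [d] rows yields its own copy of the
    voltage matrix. *)
Lemma coefficient_mx_intertwine i :
  coset_incidence *m arc_incidence *m coefficient_mx i =
    coefficient_mx i *m voltage_matrix aw rho.
Proof.
rewrite mul_mxrow mul_mxrow_mxblock; apply: eq_mxrow => w.
apply/matrixP => x l; rewrite [LHS]mxE [RHS]summxE.
case defx: (enum_val x) => [u g].
transitivity (\sum_(a in arcs_between u (enum_val w))
   \sum_(h in vgroup aw u) rho (g * (h * voltage aw a))%g i l).
  pose f (y : VG) := \sum_(a | gtarget a == y.1) (coset_vertex aw (gsource a)
     (y.2 * (voltage aw a)^-1)%g == coset_vertex aw u g)%:R *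
      ((y.1 == enum_val w)%:R * rho y.2 i l).
  transitivity (\sum_y f y).
    rewrite -(sum_enum_val f); apply: eq_bigr => y _.
    rewrite coset_arc_incidenceE defx mulr_suml.
    by rewrite [coefficient_block _ _ _ _]mxE.
  rewrite (exchange_big_dep xpredT) //= [RHS]big_mkcond /=.
  apply: eq_bigr => a _; under eq_bigl => y do rewrite eq_sym.
  (* Together the two substitutions write the group element as [g * (h * voltage aw a)], which turns
     the coset condition into [h \in vgroup aw u]. *)
  rewrite sum_fiber /= (reindex_inj (mulgI g)).
  rewrite (reindex_inj (mulIg (voltage aw a))) /=.
  rewrite inE; under eq_bigr => h _.
    rewrite mulgA mulgK coset_vertex_eq mulKg mulrA -natrM mulnb.
    rewrite andbAC -mulnb natrM -mulrA.
    over.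
  rewrite -mulr_sumr; case: (_ && _); rewrite ?mul0r // mul1r [RHS]big_mkcond.
  by apply: eq_bigr => h _; case: ifP => _; rewrite ?mul0r ?mul1r ?mulgA.
(* Row [(u, g)] of the coefficient matrix vanishes outside block [u]. *)
rewrite (bigD1 (enum_rank u)) //= [X in _ + X]big1 ?addr0 => [|v neq_vu].
  rewrite coefficient_blockM defx enum_rankK eqxx mul1r mulmx_sumr summxE.
  apply: eq_bigr => a _; rewrite mulmx_sumr summxE.
  by apply: eq_bigr => h _; rewrite repr_mxM ?inE.
rewrite -(can_eq enum_valK) enum_rankK eq_sym in neq_vu.
by rewrite coefficient_blockM defx (negPf neq_vu) mul0r.
Qed.

End Block.

(** * All irreducible representations together *)

Hypothesis F'G : ([pchar F]^'.-group [set: gT])%g.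
Context (nu : nat) (d : 'I_nu -> nat).
Context (rho : forall r, mx_representation F [set: gT] (d r)).
Hypothesis rhoP : complete_irr_set rho.
Hypothesis nuE : nu = #|classes [set: gT]|.

Definition fourier_mx :
    'M[F]_(#|{: VG}|, \sum_(r < nu) \sum_(i < d r) \sum_(v < k) d r) :=
  \mxrow_r \mxrow_i coefficient_mx (rho r) i.

(** For a row vector [c] killed by the matrix and a fixed vertex [u], the function sending [g] to
    the entry of [c] at [(u, g)] is killed by every [rho r], hence is zero. *)
Lemma fourier_mx_free : row_free fourier_mx.
Proof.
rewrite -kermx_eq0; apply/rowV0P => c /sub_kermxP.
rewrite mul_mxrow => cT0; apply/rowP => x; rewrite mxE.
case defx: (enum_val x) => [u g].
suff /(_ g) : forall g, c 0 (enum_rank (u, g)) = 0 by rewrite -defx enum_valK.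
apply: (complete_irr_faithful F'G rhoP) => r.
apply/matrixP => i l; rewrite summxE mxE.
have := cT0; rewrite -mxrow0 => /eq_mxrowP/(_ r).
rewrite mul_mxrow -[0]mxrow0 => /eq_mxrowP/(_ i).
rewrite mul_mxrow -[0]mxrow0 => /eq_mxrowP/(_ (enum_rank u))/matrixP/(_ 0 l).
rewrite !mxE => cT0_l; rewrite -[RHS]cT0_l.
pose f (y : VG) := c 0 (enum_rank y) * ((y.1 == u)%:R * rho r y.2 i l).
transitivity (\sum_y f y); last first.
  rewrite -(sum_enum_val f); apply: eq_bigr => y _.
  by rewrite /f enum_valK mxE enum_rankK.
transitivity (\sum_(y | y.1 == u) f y).
  by rewrite sum_fiber; apply: eq_bigr => h _; rewrite /f eqxx mul1r mxE.
rewrite big_mkcond; apply: eq_bigr => y _; rewrite /f.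
by case: eqP; rewrite ?mul0r ?mulr0.
Qed.

Lemma fourier_size :
  #|{: VG}| = (\sum_(r < nu) \sum_(i < d r) \sum_(v < k) d r)%N.
Proof.
rewrite card_prod -(cardsT gT) -(sum_complete_irr_degree F'G rhoP nuE).
rewrite big_distrr /=.
by apply: eq_bigr => r _; rewrite !sum_nat_const !card_ord mulnCA.
Qed.

Lemma fourier_mx_intertwine :
  coset_incidence *m arc_incidence *m fourier_mx =
    fourier_mx *m \mxdiag_r \mxdiag_(i < d r) voltage_matrix aw (rho r).
Proof.
rewrite mul_mxrow mul_mxrow_mxdiag; apply: eq_mxrow => r.
rewrite mul_mxrow mul_mxrow_mxdiag; apply: eq_mxrow => i.
exact: coefficient_mx_intertwine.
Qed.

(** The factor [d r] in the multiset is the number of equal diagonal blocks, one for each row of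
    [rho r]. *)
Lemma voltage_spectrumE :
  voltage_spectrum aw rho = sp (coset_incidence *m arc_incidence).
Proof.
apply/msetP => x; rewrite spE.
rewrite (char_poly_intertwine fourier_size fourier_mx_free
           fourier_mx_intertwine).
rewrite char_poly_mxdiag mup_prod => [|r]; last exact: char_poly_neq0.
have msetDx : {morph (fun A : {mset F} => A x) : A B / A `+` B >-> (A + B)%N}.
  by move=> A B; rewrite msetE2.
rewrite (big_morph _ msetDx (mset0E x)).
apply: eq_bigr => r _; rewrite mset_scaleE spE char_poly_mxdiag.
rewrite mup_prod => [|i]; last exact: char_poly_neq0.
by rewrite [RHS]sum_nat_const card_ord.
Qed.

Lemma voltage_spectrum_lift :
  voltage_spectrum aw rho =
    msetn (k * #|[set: gT]| - komega aw)%N 0 `+`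
      graph_spectrum F (factored_lift aw).
Proof.
have card_VG : #|{: VG}| = (k * #|[set: gT]|)%N by rewrite card_prod cardsT.
rewrite voltage_spectrumE /graph_spectrum adjacency_factored_lift.
rewrite -card_VG -card_lift_vertex -sp_mulmxC //.
by rewrite card_VG card_lift_vertex leq_komega.
Qed.

End LiftFactorization.

Theorem theorem4p3 (R : realType) (Gamma : graph) (gT : finGroupType)
    (aw : voltage_assignment Gamma gT)
    (d : 'I_#|classes [set: gT]| -> nat)
    (rho : forall r, mx_representation R[i] [set: gT] (d r))
    (Hrho : complete_irr_set rho) :
  let k := #|gvertex Gamma| in
  let n := #|[set: gT]| in
  let B : {mset R[i]} := voltage_spectrum aw rho in
  let Z : {mset R[i]} := msetn (k * n - komega aw)%N 0 in
  [/\ #|gvertex (factored_lift aw)| = komega aw,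
      (\sum_r d r ^ 2)%N = n,
      size B = (k * n)%N,
      (count (fun x : R[i] => x != 0%R) B <= komega aw)%N
    & Z `<=` B /\ graph_spectrum R[i] (factored_lift aw) = B `\` Z].
Proof.
move=> k n B Z.
(* Characteristic 0 makes the order of the group invertible, as Maschke's theorem requires. *)
have F'G : ([pchar R[i]]^'.-group [set: gT])%g.
  by rewrite /pgroup pcharf'_nat pnatr_eq0 -lt0n cardG_gt0.
have BE : B = Z `+` graph_spectrum R[i] (factored_lift aw).
  exact: voltage_spectrum_lift.
have card_lift := card_lift_vertex aw.
split => //; first exact: (sum_complete_irr_degree F'G Hrho).
- rewrite /B (voltage_spectrumE aw F'G Hrho (erefl _)) size_sp.
  by rewrite card_prod -(cardsT gT).
- rewrite -card_lift -(size_sp (adjacency R[i] (factored_lift aw))).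
  (* The zeros of [Z] do not contribute to the count, and the rest is bounded by the order of the
     lift. *)
  have /seq.permP -> : perm_eq B (Z ++ graph_spectrum R[i] (factored_lift aw)).
    by apply/allP => x _; rewrite /= count_cat !count_mem_mset BE msetE2.
  rewrite count_cat enum_msetn count_nseq eqxx mul0n add0n.
  exact: count_size.
- rewrite BE msetDKB; split=> //; apply/msubsetP => x.
  by rewrite msetE2 leq_addr.
Qed.
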